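(* Let $\mathbf{T}$ be a tree chosen uniformly at random from the $n^{n-2}$ labelled trees on vertex set $\{1,\ldots,n\}$, and for $0\le k\le n$ let $X_k$ be the number of independent sets of size $k$ in $\mathbf{T}$. Then asymptotically almost surely (i.e., with probability tending to $1$ as $n\to\infty$) the sequence $(X_\ell, X_{\ell+1},\ldots,X_n)$ is weakly decreasing, where $\ell=0.34668n$ (i.e. $X_k\ge X_{k+1}$ for every integer $k$ with $0.34668n\le k\le n-1$).
   Context: An independent set in a graph is a set of mutually non-adjacent vertices. *)

(* Defs.v *)
From mathcomp Require Import all_boot all_order all_algebra.

Set Implicit Arguments.
Unset Strict Implicit.
Unset Printing Implicit Defensive.

Import GRing.Theory.

(* A graph on V is represented by its set E of edges, an edge being the
   unordered pair of its end points. *)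
Section Graphs.
Variable V : finType.
Implicit Type E : {set {set V}}.

Definition simple_graph E : bool := [forall e in E, #|e| == 2].

Definition adj E : rel V := fun x y => [set x; y] \in E.

Definition connected_graph E : bool :=
  (0 < #|V|) && [forall x, forall y, connect (adj E) x y].

(* A cycle is a sequence of at least three distinct vertices, cyclically
   adjacent. As it has at most #|V| vertices, bounding its length loses
   nothing (see acyclicP) and keeps the predicate boolean. *)
Definition acyclic_graph E : bool :=
  [forall k : 'I_#|V|.+1, forall c : k.-tuple V,
     ~~ ((3 <= size c) && ucycleb (adj E) c)].

Lemma acyclicP E :
  reflect (forall c : seq V, 3 <= size c -> ~ ucycle (adj E) c)
          (acyclic_graph E).
Proof.
apply: (iffP forallP) => [acE c c_ge3 cycc | acE k].
  have cV : size c < #|V|.+1.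
    by case/andP: cycc => _ /card_uniqP <-; rewrite ltnS max_card.
  have /forallP/(_ (in_tuple c)) := acE (Ordinal cV).
  by rewrite /= c_ge3 => /negP.
by apply/forallP => c; apply/negP => /andP[c_ge3]; apply: acE.
Qed.

Definition is_tree E : bool :=
  [&& simple_graph E, connected_graph E & acyclic_graph E].

Definition independent E (S : {set V}) : bool :=
  [forall x in S, forall y in S, ~~ adj E x y].

Definition num_independent E (k : nat) : nat :=
  #|[set S : {set V} | independent E S & #|S| == k]|.

End Graphs.

(* The labels 1, ..., n are shifted to 0, ..., n-1. Distinct edge sets are
   distinct labelled trees: there is no quotient by isomorphism. *)
Definition labelled_trees (n : nat) : {set {set {set 'I_n}}} :=
  [set E | is_tree E].

Definition prob_random_tree (R : realFieldType) (n : nat)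
    (A : pred {set {set 'I_n}}) : R :=
  (#|[set T in labelled_trees n | A T]|%:R / #|labelled_trees n|%:R)%R.

(* Main.v *)
Require Import Defs.
From mathcomp Require Import all_boot all_order all_algebra boolp.
From mathcomp Require Import zify ring lra.
Import Order.TTheory GRing.Theory Num.Theory.

Set Implicit Arguments.
Unset Strict Implicit.
Unset Printing Implicit Defensive.

(* For an independent set S of a tree T, let ext(S) be the set of the vertices
   outside S that have no neighbour in S. Double counting gives
   (k+1) X_{k+1} <= sum_{|S| = k} |ext(S)|, so X_{k+1} > X_k can only come from
   the S with |ext(S)| > k. Each of these has at least 'C(k, u) subsets U of
   ext(S) of size u, whence X_k 'C(k, u) <= n Q, where Q counts the pairs (S, U).
   Every tree has X_k >= 'C(n + 1 - k, k). On the other hand a tree is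
   determined by a map sending each vertex to a neighbour; for a given pair
   (S, U) this map avoids S and U on S, and avoids S on U, so summing Q over all
   trees gives at most
     'C(n, k) 'C(n - k, u) (n - k - u)^k (n - k)^u n^(n - k - u),
   while there are at least n^(n - 2) trees. By Markov's inequality it remains
   to compare exponential rates. The choice u = 82 n / 375 works for k from
   130 n / 375 = 0.34666... n, where it is near the optimum and the rate is
   barely negative, up to 0.39 n; from there on u = k is enough. *)

(** * Trees and their independent sets *)

Section TreeParent.
Variable V : finType.
Implicit Types (E : {set {set V}}) (W S U : {set V}).

Lemma adjC E x y : adj E x y = adj E y x.
Proof. by rewrite /adj setUC. Qed.

Lemma adj_neq E x y : simple_graph E -> adj E x y -> x != y.
Proof.
move=> /forall_inP sE /sE; rewrite cards2 => /eqP [].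
by case: (x != y).
Qed.

(** Take for d the distance to r: the second vertex of a shortest walk from v to r is a neighbour of
    v that is closer to r. *)
Lemma connected_depth E (r : V) : connected_graph E ->
  exists f : V -> V, exists d : V -> nat,
    forall v, v != r -> adj E v (f v) /\ d (f v) < d v.
Proof.
case/andP=> _ /forallP conE.
pose P v m := [exists p : m.-tuple V, path (adj E) v p && (last v p == r)].
have exP v : exists m, P v m.
  have /forallP/(_ r)/connectP[p pp lp] := conE v.
  exists (size p); apply/existsP; exists (in_tuple p).
  by rewrite /= pp -lp eqxx.
pose d v := ex_minn (exP v).
have step v : v != r -> exists w, adj E v w && (d w < d v).
  move=> vr; rewrite /d; case: (ex_minnP (exP v)) => m /existsP[p] + _.
  case/andP; case: p => -[|w p] /= sp; first by move=> _ /eqP vr'; rewrite vr' eqxx in vr.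
  case/andP=> vw pp lp; exists w; rewrite vw /=.
  case: (ex_minnP (exP w)) => m' _ /(_ (size p)) H.
  move/eqP: sp => <-; apply: H; apply/existsP; exists (in_tuple p).
  by rewrite /= pp.
exists (fun v => odflt v [pick w | adj E v w && (d w < d v)]), d => v /step [w vw].
by case: pickP => [w' /andP[]//|/(_ w)]; rewrite vw.
Qed.

(** An edge that does not join a vertex to its parent would close the path of parent edges between
    its ends into a cycle. *)
Lemma tree_parent E : is_tree E -> 1 < #|V| ->
  exists r : V, exists f : V -> V, exists d : V -> nat,
  [/\ forall v, adj E v (f v),
      forall v, v != r -> d (f v) < d v
    & forall x y, adj E x y -> x != r /\ y = f x \/ y != r /\ x = f y].
Proof.
case/and3P=> sE cE /acyclicP aE V1.
have [r _] : exists r, r \in V by apply/card_gt0P; apply: ltnW.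
have [f [d fd]] := connected_depth r cE.
have [s rs] : exists s, adj E r s.
  have [s sr] : exists s, s != r.
    have : 0 < #|predC1 r| by rewrite cardC1; case: #|V| V1 => [|[]].
    by case/card_gt0P=> s; exists s.
  case/andP: cE => _ /forallP/(_ r)/forallP/(_ s)/connectP[[|t p]] /=.
    by move=> _ rs; rewrite rs eqxx in sr.
  by case/andP=> rt _ _; exists t.
(* The root has no parent; an arbitrary neighbour s stands in, so that g sends every vertex to a
   neighbour. *)
pose g v := if v == r then s else f v.
have gE v : adj E v (g v).
  by rewrite /g; case: eqVneq => [->//|/fd[]].
have gd v : v != r -> d (g v) < d v.
  by move=> vr; rewrite /g (negPf vr); case: (fd v vr).
pose e := [rel x y | (x != r) && (y == g x) || (y != r) && (x == g y)].
have eE : subrel e (adj E).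
  by move=> x y /orP[] /andP[_ /eqP ->]; rewrite // adjC.
have esym : connect_sym e.
  by apply: sym_connect_sym => x y; rewrite /= orbC.
have cr v : connect e v r.
  have [m] := ubnP (d v); elim: m v => // m IH v dv.
  case: (eqVneq v r) => [->//|vr].
  apply: (@connect_trans _ _ (g v)); first by apply: connect1; rewrite /= vr eqxx.
  by apply: IH; apply: leq_trans (gd _ vr) _.
exists r, g, d; split=> // x y xy.
have [/orP[/andP[xr /eqP]|/andP[yr /eqP]]|nxy] := boolP (e x y); [by left|by right|].
have : connect e x y.
  by apply: connect_trans (cr x) _; rewrite esym.
case/connectP=> p pp lp; move: lp.
case/shortenP: pp => q qq uq _ lq.
(* The simple path q from x to y has at least two edges, since x and y are distinct and no parent
   edge joins them; the edge xy closes it. *)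
case: (aE (x :: q)).
  case: q qq uq lq => [|z [|z' q]] //=.
    by move=> _ _ yx; move: (adj_neq sE xy); rewrite yx eqxx.
  by rewrite andbT => xz _ yz; rewrite yz /= xz in nxy.
rewrite /ucycle uq andbT /= rcons_path -lq adjC xy andbT.
exact: sub_path qq.
Qed.

End TreeParent.

Section IndependentSets.
Variable V : finType.
Implicit Types (E : {set {set V}}) (W S U : {set V}).

Lemma independentP E S :
  reflect {in S &, forall x y, ~~ adj E x y} (independent E S).
Proof.
apply: (iffP forall_inP) => [H x y xS yS | H x xS].
  by have /forall_inP := H x xS; apply.
by apply/forall_inP => y yS; apply: H.
Qed.

Lemma independentS E S S' : S \subset S' -> independent E S' -> independent E S.
Proof.
by move=> /subsetP SS /independentP H; apply/independentP => x y xS yS; apply: H; apply: SS.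
Qed.

(* Equality holds for a path, which thus has the fewest independent sets. *)
Lemma num_independent_ge E : is_tree E -> 1 < #|V| ->
  forall k, 'C(#|V|.+1 - k, k) <= num_independent E k.
Proof.
move=> tE V1 k; have [r [f [d [fE fd Ef]]]] := tree_parent tE V1.
have sE : simple_graph E by case/and3P: tE.
(* For the induction, count inside an arbitrary vertex set W, which spans a forest. *)
pose I W k := #|[set S : {set V} | [&& S \subset W, independent E S & #|S| == k]]|.
suff H W j : 'C(#|W|.+1 - j, j) <= I W j.
  have := H setT k; rewrite cardsT => /leq_trans; apply; apply: subset_leq_card.
  by apply/subsetP => S; rewrite !inE => /and3P[_ -> ->].
have [m] := ubnP #|W|; elim: m W j => // m IH W [|j] Wm.
  rewrite bin0 /I; apply/card_gt0P; exists set0; rewrite inE sub0set cards0 eqxx andbT.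
  by apply/independentP => x y; rewrite inE.
have [W0|/set0Pn[w0 w0W]] := eqVneq W set0.
  by rewrite W0 cards0.
(* A deepest vertex v of W has no neighbour in W except possibly its parent [f v]. *)
have [v vW vmax] : exists2 v, v \in W & forall w, w \in W -> d w <= d v.
  by case: (arg_maxnP d w0W) => v vW H; exists v.
have nbr w : w \in W -> adj E v w -> w = f v.
  move=> wW /Ef[[]//|[wr vfw]].
  by have := fd _ wr; rewrite -vfw ltnNge vmax.
have Ej : #|W :\ v| = #|W|.-1 by rewrite (cardsD1 v W) vW.
have Wgt0 : 0 < #|W| by apply/card_gt0P; exists v.
pose W' := W :\ v :\ f v.
have W'ge : #|W| - 2 <= #|W'|.
  by have := cardsD1 (f v) (W :\ v); rewrite Ej -/W'; case: (_ \in _); lia.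
have IH1 : 'C(#|W| - j.+1, j.+1) <= I (W :\ v) j.+1.
  apply: leq_trans (IH (W :\ v) j.+1 _); last by rewrite Ej; lia.
  by apply: leq_bin2l; rewrite Ej; lia.
have IH2 : 'C(#|W|.-1 - j, j) <= I W' j.
  apply: leq_trans (IH W' j _); first by apply: leq_bin2l; lia.
  by apply: leq_ltn_trans (subset_leq_card (subsetDl _ _)) _; rewrite Ej; lia.
(* Pascal's rule: [A1] holds the sets avoiding v, and adding v to the sets of [A2], which avoid v
   and [f v], gives sets containing v. *)
pose A1 := [set S : {set V} | [&& S \subset W :\ v, independent E S & #|S| == j.+1]].
pose A2 := [set S : {set V} | [&& S \subset W', independent E S & #|S| == j]].
have A2v S : S \in A2 -> v \notin S.
  rewrite inE => /andP[/subsetP SW _]; apply/negP => /SW.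
  by rewrite !inE eqxx andbF.
have inj2 : {in A2 &, injective (fun S => v |: S)}.
  by move=> S S' /A2v vS /A2v vS' /(congr1 (fun X => X :\ v)); rewrite !setU1K.
have dis : [disjoint A1 & [set v |: S | S in A2]].
  rewrite disjoint_subset; apply/subsetP => S; rewrite !inE => /andP[/subsetP SW _].
  apply/negP => /imsetP[S' _ SE].
  by have := SW v; rewrite SE !inE eqxx => /(_ isT).
have sub : A1 :|: [set v |: S | S in A2] \subset
    [set S : {set V} | [&& S \subset W, independent E S & #|S| == j.+1]].
  rewrite subUset; apply/andP; split.
    apply/subsetP => S; rewrite !inE => /and3P[SW -> ->]; rewrite !andbT.
    exact: subset_trans SW (subsetDl _ _).
  apply/subsetP => _ /imsetP[S SA ->]; rewrite inE cardsU1 (A2v _ SA).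
  move: SA; rewrite inE => /and3P[/subsetP SW /independentP Si /eqP ->].
  rewrite eqxx andbT; apply/andP; split.
    apply/subsetP => x /setU1P[->//|/SW]; rewrite !inE; by case/and3P.
  have vn x : x \in S -> ~~ adj E v x.
    move=> /SW; rewrite !inE => /and3P[xf _ xW]; apply/negP => /(nbr _ xW) xE.
    by rewrite xE eqxx in xf.
  apply/independentP => x y /setU1P[->|xS] /setU1P[->|yS].
  - by apply/negP => /(adj_neq sE); rewrite eqxx.
  - exact: vn.
  - by rewrite adjC; apply: vn.
  - exact: Si.
apply: leq_trans (subset_leq_card sub).
have -> : #|A1 :|: [set v |: S | S in A2]| = #|A1| + #|[set v |: S | S in A2]|.
  by apply/eqP; rewrite (leq_card_setU A1 _).2.
rewrite (card_in_imset inj2).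
apply: leq_trans (leq_add IH1 IH2).
have [Wj|Wj] := leqP #|W| j.
  by rewrite (_ : #|W|.+1 - j.+1 = 0) ?bin0n //; lia.
rewrite (_ : #|W|.+1 - j.+1 = (#|W| - j.+1).+1); last lia.
rewrite binS leq_add2l; apply: leq_bin2l; lia.
Qed.

Definition ext E S := [set v | (v \notin S) && [forall x in S, ~~ adj E x v]].

(** Removing a vertex v from an independent set of size k+1 leaves a set S with v in ext(S), and the
    pair (S, v) determines the original set. *)
Lemma num_independentS_le E k : simple_graph E ->
  k.+1 * num_independent E k.+1 <=
  \sum_(S : {set V} | independent E S && (#|S| == k)) #|ext E S|.
Proof.
move=> sE.
pose A := [set p : {set V} * V | [&& independent E p.1, #|p.1| == k.+1 & p.2 \in p.1]].
pose B := [set p : {set V} * V | [&& independent E p.1, #|p.1| == k & p.2 \in ext E p.1]].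
have -> : k.+1 * num_independent E k.+1 = #|A|.
  rewrite /num_independent -sum1_card big_distrr /= muln1.
  rewrite -sum1_card (eq_bigl (fun p => (independent E p.1 && (#|p.1| == k.+1)) && (p.2 \in p.1))); last first.
    by move=> p; rewrite inE andbA.
  rewrite -(pair_big_dep (fun S => independent E S && (#|S| == k.+1)) (fun S v => v \in S) (fun _ _ => 1)) /=.
  rewrite (eq_bigl (fun S => independent E S && (#|S| == k.+1))); last by move=> S; rewrite inE.
  by apply: eq_bigr => S /andP[_ /eqP Sk]; rewrite sum1_card Sk.
have -> : \sum_(S : {set V} | independent E S && (#|S| == k)) #|ext E S| = #|B|.
  rewrite -[RHS]sum1_card (eq_bigl (fun p => (independent E p.1 && (#|p.1| == k)) && (p.2 \in ext E p.1))); last first.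
    by move=> p; rewrite inE andbA.
  rewrite -(pair_big_dep (fun S => independent E S && (#|S| == k)) (fun S v => v \in ext E S) (fun _ _ => 1)) /=.
  by apply: eq_bigr => S _; rewrite sum1_card.
have inj : {in A &, injective (fun p : {set V} * V => (p.1 :\ p.2, p.2))}.
  move=> [S v] [S' v']; rewrite !inE /= => /and3P[_ _ vS] /and3P[_ _ vS'] [SE vE].
  by rewrite -(setD1K vS) -(setD1K vS') SE vE.
rewrite -(card_in_imset inj); apply: subset_leq_card.
apply/subsetP => _ /imsetP[[S v] + ->]; rewrite !inE /= => /and3P[Si Sk vS].
rewrite eqxx /=; apply/and3P; split.
- exact: independentS (subsetDl _ _) Si.
- by move: Sk; rewrite (cardsD1 v S) vS add1n eqSS.
- apply/forall_inP => x; rewrite !inE => /andP[_ xS].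
  by move/independentP: Si; apply.
Qed.

Definition nonadjacent_pairs E k u :=
  [set p : {set V} * {set V} |
    [&& independent E p.1, #|p.1| == k, p.2 \subset ext E p.1 & #|p.2| == u]].

Lemma card_nonadjacent_pairs E k u :
  #|nonadjacent_pairs E k u| =
  \sum_(S : {set V} | independent E S && (#|S| == k)) 'C(#|ext E S|, u).
Proof.
rewrite -sum1_card (eq_bigl (fun p : {set V} * {set V} =>
   (independent E p.1 && (#|p.1| == k)) && ((p.2 \subset ext E p.1) && (#|p.2| == u)))); last first.
  by move=> p; rewrite inE !andbA.
rewrite -(pair_big_dep (fun S => independent E S && (#|S| == k))
  (fun S U => (U \subset ext E S) && (#|U| == u)) (fun _ _ => 1)) /=.
apply: eq_bigr => S _; rewrite -cards_draws -sum1_card.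
by apply: eq_bigl => U; rewrite inE.
Qed.

(** The sum of |ext(S)| is at least (k+1) X_k. The sets with |ext(S)| <= k account for at most k X_k
    of it; for the others |ext(S)| <= n and 'C(k, u) <= 'C(|ext(S)|, u), which bounds the remaining
    X_k. *)
Lemma num_independent_lt E k u : simple_graph E -> u <= k ->
  num_independent E k < num_independent E k.+1 ->
  0 < num_independent E k /\
  num_independent E k * 'C(k, u) <= #|V| * #|nonadjacent_pairs E k u|.
Proof.
move=> sE uk lt; have le := num_independentS_le k sE.
have XE : num_independent E k = \sum_(S : {set V} | independent E S && (#|S| == k)) 1.
  by rewrite /num_independent -sum1_card; apply: eq_bigl => S; rewrite inE.
split.
  rewrite lt0n; apply/negP => /eqP X0; move: le; rewrite big_pred0 => [|S]; first by lia.
  by apply/negP => H; move/eqP: X0; rewrite XE (bigD1 S).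
have : \sum_(S : {set V} | independent E S && (#|S| == k)) #|ext E S| * 'C(k, u) <=
  \sum_(S : {set V} | independent E S && (#|S| == k)) (k * 'C(k, u) + #|V| * 'C(#|ext E S|, u)).
  apply: leq_sum => S _; have [ek|ke] := leqP #|ext E S| k.
    by apply: leq_trans (leq_addr _ _); rewrite leq_mul2r ek orbT.
  apply: leq_trans (leq_addl _ _); apply: leq_mul; first exact: max_card.
  by apply: leq_bin2l; apply: ltnW.
rewrite big_split /= -big_distrl -[X in _ + X]big_distrr /= -card_nonadjacent_pairs.
rewrite (_ : \sum_(i | _) (k * 'C(k, u)) = num_independent E k * (k * 'C(k, u))); last first.
  by rewrite XE big_distrl /=; apply: eq_bigr => S _; rewrite mul1n.
move: (\sum_(S | _) _) le => s le H.
have : k.+1 * (num_independent E k) * 'C(k, u) <= s * 'C(k, u).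
  rewrite leq_mul2r; apply/orP; right; apply: leq_trans le; rewrite leq_mul2l; apply/orP; right.
  exact: ltnW.
move/leq_trans => /(_ _ H).
by rewrite mulSn mulnDl [k * _]mulnC -mulnA addnC leq_add2l.
Qed.

End IndependentSets.

(** * Counting trees *)

Section CountPairs.
Variable V : finType.
Implicit Types (E T : {set {set V}}) (W S U : {set V}).

Definition trees : {set {set {set V}}} := [set E | is_tree E].

Definition edges_of (f : {ffun V -> V}) : {set {set V}} := [set [set v; f v] | v in V].

(** The value at the root adds no new edge, being a neighbour too. Counting trees is thereby reduced
    to counting maps. *)
Lemma tree_edges_of T : is_tree T -> 1 < #|V| ->
  exists2 f : {ffun V -> V}, forall v, adj T v (f v) & T = edges_of f.
Proof.
move=> tT V1; have [r [f [d [fE fd Ef]]]] := tree_parent tT V1.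
exists (finfun f) => [v|]; first by rewrite ffunE.
apply/setP => e; apply/idP/imsetP => [eT|[v _ ->]]; last by rewrite ffunE; apply: fE.
have /forall_inP sT : simple_graph T by case/and3P: tT.
have /cards2P[x [y [_ exy]]] := sT e eT.
have /Ef [[_ yE]|[_ xE]] : adj T x y by rewrite /adj -exy.
  by apply: (ex_intro2 _ _ x); rewrite ?inE ?ffunE -?yE //.
by apply: (ex_intro2 _ _ y); rewrite ?inE ?ffunE -?xE ?exy 1?setUC //.
Qed.

Lemma card_family_prod (F : V -> {set V}) :
  #|family F| = \prod_v #|F v|.
Proof. by rewrite card_family foldrE big_image. Qed.

(** A tree T is recovered from a chosen neighbour map [phi T], so [phi] is injective on trees; it
    remains to count the maps with the allowed values. *)
Lemma card_trees_nonadjacent S U : 1 < #|V| -> [disjoint S & U] ->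
  #|[set T in trees | independent T S && (U \subset ext T S)]| <=
  (#|V| - #|S| - #|U|) ^ #|S| * (#|V| - #|S|) ^ #|U| * #|V| ^ (#|V| - #|S| - #|U|).
Proof.
move=> V1 dSU.
have cSU : #|S :|: U| = #|S| + #|U|.
  by apply/eqP; rewrite (leq_card_setU S U).2.
pose phi T := odflt [ffun v => v]
  [pick f : {ffun V -> V} | [forall v, adj T v (f v)] && (T == edges_of f)].
have phiP T : T \in trees -> (forall v, adj T v (phi T v)) /\ T = edges_of (phi T).
  rewrite inE => /tree_edges_of /(_ V1) [f fT Tf]; rewrite /phi; case: pickP => [g|].
    by case/andP=> /forallP gT /eqP.
  move/(_ f); rewrite -Tf eqxx andbT => /negP; case.
  exact/forallP.
(* Independence of S excludes S on S; the inclusion of U in ext(S) excludes U on S and S on U. Edges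
   inside U remain possible. *)
pose F v := if v \in S then ~: (S :|: U) else if v \in U then ~: S else [set: V].
have -> : (#|V| - #|S| - #|U|) ^ #|S| * (#|V| - #|S|) ^ #|U| *
    #|V| ^ (#|V| - #|S| - #|U|) = #|family F|.
  rewrite card_family_prod (bigID (mem S)) /= (bigID (mem U) (fun i => i \notin S)) /=.
  rewrite -mulnA; congr (_ * (_ * _)).
  - rewrite (eq_bigr (fun=> #|V| - #|S| - #|U|)) ?prod_nat_const // => v vS.
    by rewrite /F vS cardsCs setCK cSU subnDA.
  - rewrite (eq_bigl (mem U)) => [|v]; last first.
      apply/andP/idP => [[]//|vU]; by rewrite (disjointFl dSU vU).
    rewrite (eq_bigr (fun=> #|V| - #|S|)) ?prod_nat_const // => v vU.
    by rewrite /F (disjointFl dSU vU) (vU : v \in U) cardsCs setCK.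
  rewrite (eq_bigr (fun=> #|V|)) => [|v /andP[/negPf vS /negPf vU]]; last first.
    by rewrite /F vS vU cardsT.
  rewrite prod_nat_const -subnDA -cSU -[X in X - _]cardsT -cardsDS ?subsetT //.
  congr (_ ^ _); apply: eq_card => v.
  by rewrite !inE negb_or andbT.
rewrite -(@card_in_imset _ _ phi) => [|T T']; last first.
  rewrite in_set => /andP[/phiP[_ eT] _].
  rewrite in_set => /andP[/phiP[_ eT'] _] eqphi.
  by rewrite eT eT' eqphi.
apply: subset_leq_card; apply/subsetP => _ /imsetP[T + ->].
rewrite inE => /andP[/phiP[pT _] /andP[/independentP iS /subsetP US]].
apply/familyP => v; rewrite /F.
have nU x y : x \in S -> y \in U -> ~~ adj T x y.
  by move=> xS /US; rewrite inE => /andP[_ /forall_inP]; apply.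
case: ifP => vS.
  rewrite !inE; apply/negP => /orP[fS|fU].
    by have := iS _ _ vS fS; rewrite pT.
  by have := nU _ _ vS fU; rewrite pT.
case: ifP => vU; rewrite !inE //; apply/negP => fS.
by have := nU _ _ fS vU; rewrite adjC pT.
Qed.

Lemma sum_nonadjacent_pairs k u : 1 < #|V| ->
  \sum_(T in trees) #|nonadjacent_pairs T k u| <=
  'C(#|V|, k) * 'C(#|V| - k, u) *
   ((#|V| - k - u) ^ k * (#|V| - k) ^ u * #|V| ^ (#|V| - k - u)).
Proof.
move=> V1; set N := _ ^ _ * _ * _.
under eq_bigr do rewrite -sum1_card.
rewrite (exchange_big_dep (fun p : {set V} * {set V} =>
  (#|p.1| == k) && ([disjoint p.1 & p.2] && (#|p.2| == u)))) /=; last first.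
  move=> T [S U] _; rewrite inE /= => /and4P[_ -> /subsetP US ->]; rewrite andbT /=.
  rewrite disjoint_sym disjoint_subset; apply/subsetP => x /US.
  by rewrite !inE => /andP[].
apply: (@leq_trans (\sum_(p : {set V} * {set V} | (#|p.1| == k) &&
   ([disjoint p.1 & p.2] && (#|p.2| == u))) N)).
  apply: leq_sum => -[S U] /= /and3P[/eqP Sk dSU /eqP Uu].
  have := card_trees_nonadjacent V1 dSU; rewrite Sk Uu -/N; apply: leq_trans.
  rewrite sum1dep_card; apply: subset_leq_card; apply/subsetP => T.
  by rewrite !inE /= => /andP[-> /and4P[-> _ ->]].
rewrite -(pair_big_dep (fun S : {set V} => #|S| == k)
  (fun S U => [disjoint S & U] && (#|U| == u)) (fun _ _ => N)) /=.
rewrite (eq_bigr (fun=> 'C(#|V| - k, u) * N)) => [|S /eqP Sk]; last first.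
  rewrite sum_nat_const; congr (_ * _).
  rewrite -Sk -[#|V|]cardsT -cardsDS ?subsetT // -cards_draws.
  apply: eq_card => U; rewrite !inE; congr (_ && _).
  by rewrite subsetD subsetT /= disjoint_sym.
by rewrite sum_nat_const -mulnA -card_draws; apply: eq_leq; congr (_ * _); apply: eq_card => S; rewrite !inE.
Qed.

(** Markov's inequality. The alternative 1 in [maxn], valid because X_k > 0, keeps the bound
    meaningful when k is so large that the binomial coefficient vanishes. *)
Lemma card_increasing k u : 1 < #|V| -> u <= k ->
  #|[set T in trees | num_independent T k < num_independent T k.+1]| *
    maxn 1 'C(#|V|.+1 - k, k) * 'C(k, u) <=
  #|V| * ('C(#|V|, k) * 'C(#|V| - k, u) *
   ((#|V| - k - u) ^ k * (#|V| - k) ^ u * #|V| ^ (#|V| - k - u))).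
Proof.
move=> V1 uk; apply: leq_trans (leq_mul (leqnn _) (sum_nonadjacent_pairs k u V1)).
rewrite -mulnA -sum_nat_const big_distrr /=.
rewrite [leqRHS](bigID (fun T => num_independent T k < num_independent T k.+1)) /=.
apply: leq_trans (leq_addr _ _).
rewrite (eq_bigl (fun T => (T \in trees) && (num_independent T k < num_independent T k.+1))); last by move=> T; rewrite !inE.
apply: leq_sum => T /andP[]; rewrite inE => tT lt.
have sT : simple_graph T by case/and3P: tT.
have [X0 X1] := num_independent_lt sT uk lt.
apply: leq_trans X1; apply: leq_mul => //.
by rewrite geq_max X0 num_independent_ge.
Qed.

End CountPairs.

(** * Cayley's lower bound on the number of trees *)

Lemma sum_subset_card (V : finType) (A : {set V}) (g : nat -> nat) :
  \sum_(C : {set V} | C \subset A) g #|C| = \sum_(j < #|A|.+1) 'C(#|A|, j) * g j.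
Proof.
rewrite (partition_big (fun C : {set V} => inord #|C| : 'I_#|A|.+1) xpredT) //=.
apply: eq_bigr => j _; rewrite -cards_draws -sum_nat_const.
apply: eq_big => [C|C /andP[CA /eqP <-]].
  rewrite inE; case: (boolP (C \subset A)) => //= CA.
  by rewrite -val_eqE /= inordK // ltnS subset_leq_card.
by rewrite inordK // ltnS subset_leq_card.
Qed.

(** Absorption, j 'C(a, j) = a 'C(a - 1, j - 1), reduces this to the binomial theorem. In the
    recursion on forests, a and b are the sizes of A and B, and j is the number of children of the
    roots. *)
Lemma sum_bin_mul_expn a b :
  \sum_(j < a.+1) 'C(a, j) * (b ^ j * (j * a ^ (a - j))) = a * (b * (a + b) ^ a.-1).
Proof.
case: a => [|a]; first by rewrite big_ord_recl big_ord0 /= !(mul0n, muln0).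
rewrite big_ord_recl /= mul0n !muln0 add0n expnDn !big_distrr /=.
apply: eq_bigr => j _; rewrite /bump /= add1n subSS expnS.
have H := mul_bin_diag a.+1 j.
rewrite (_ : 'C(a.+1, j.+1) * (b * b ^ j * (j.+1 * a.+1 ^ (a - j))) =
  (j.+1 * 'C(a.+1, j.+1)) * (b * b ^ j * a.+1 ^ (a - j))); last by lia.
rewrite -H /=; move: (a.+1 ^ _) (b ^ _) 'C(_, _) => x y z; lia.
Qed.

Section CayleyLowerBound.
Variable V : finType.
Implicit Types (A B C : {set V}).

(* The parent functions of the forests on A :|: B with set of roots B,
   extended by the identity outside A; the depth d excludes cycles. *)
Definition parent_fun A B (f : {ffun V -> V}) :=
  [/\ {in A, forall v, f v \in A :|: B}, {in ~: A, forall v, f v = v}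
    & exists d : V -> nat, {in A, forall v, d (f v) < d v}].

Definition parent_funs A B : {set {ffun V -> V}} := [set f | `[< parent_fun A B f >]].

(* Split a forest according to the set C of the children of the roots *)
Lemma card_parent_funs_children A B C : [disjoint A & B] -> C \subset A ->
  #|B| ^ #|C| * #|parent_funs (A :\: C) C| <=
  #|[set f in parent_funs A B | [set v in A | f v \in B] == C]|.
Proof.
move=> dAB CA.
(* The singletons make [family F] the set of maps from C to B, extended by the identity. *)
pose F v := if v \in C then B else [set v].
have -> : #|B| ^ #|C| = #|family F|.
  rewrite card_family_prod (bigID (mem C)) /=.
  rewrite (eq_bigr (fun=> #|B|)) ?prod_nat_const => [|v vC]; last by rewrite /F (vC : v \in C).
  by rewrite big1 ?muln1 // => v /negPf vC; rewrite /F (vC : v \in C = false) cards1.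
(* Choose a parent in B for each vertex of C, and a forest on the rest of A with set of roots C. *)
pose glue (p : {ffun V -> V} * {ffun V -> V}) :=
  [ffun v => if v \in C then p.1 v else p.2 v].
rewrite -(cardsE (family F)) -cardsX.
have glueP p : p \in setX [set f in family F] (parent_funs (A :\: C) C) ->
  [/\ {in C, forall v, p.1 v \in B}, {in ~: C, forall v, p.1 v = v}
    & parent_fun (A :\: C) C p.2].
  case: p => g h; rewrite !inE /= => /andP[/familyP gF /asboolP hP]; split=> // v.
    by move=> vC; have := gF v; rewrite /F vC.
  by rewrite inE => /negPf vC; have := gF v; rewrite /F vC inE => /eqP.
have inj : {in setX [set f in family F] (parent_funs (A :\: C) C) &, injective glue}.
  move=> [g h] [g' h'] /glueP[/= _ gC [_ hA _]] /glueP[/= _ gC' [_ hA' _]] /ffunP eq.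
  congr (_, _); apply/ffunP => v; have := eq v; rewrite !ffunE /=.
    by case: ifP => // vC _; rewrite gC ?gC' // inE vC.
  by case: ifP => // vC _; rewrite hA ?hA' // !inE vC.
rewrite -(card_in_imset inj); apply: subset_leq_card.
apply/subsetP => _ /imsetP[[g h] /glueP[/= gB gC [hA hN [d hd]]] ->].
rewrite inE; apply/andP; split; last first.
  apply/eqP/setP => v; rewrite inE ffunE /=; case: ifP => vC.
    by rewrite (subsetP CA) // gB.
  apply/andP => -[vA]; have := hA v; rewrite !inE vC vA => /(_ isT).
  move=> hv hB; have /negP := disjointFl dAB hB; apply.
  by case/orP: hv => [/andP[]//|]; apply: (subsetP CA).
rewrite inE; apply/asboolP; split=> [v vA|v|].
- rewrite ffunE /= inE; case: ifP => vC; first by rewrite gB // orbT.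
  have := hA v; rewrite !inE vC vA => /(_ isT) /orP[/andP[_ ->]//|/(subsetP CA) ->//].
- rewrite inE ffunE /= => vA.
  have vC : v \in C = false by apply/negP => /(subsetP CA); apply/negP.
  by rewrite vC; apply: hN; rewrite !inE vC.
(* Roots get depth 0 and their children depth 1; the old depths are shifted by 2 to stay above
   both. *)
exists (fun v => if v \in C then 1 else if v \in A then (d v).+2 else 0) => v vA.
rewrite ffunE /=; case vC: (v \in C).
  have gvA := disjointFl dAB (gB _ vC).
  rewrite gvA; case: ifP => // gvC.
  by move: (subsetP CA _ gvC); rewrite gvA.
rewrite vA; case: ifP => // hvC; case: ifP => // hvA.
by rewrite !ltnS; apply: hd; rewrite inE vC.
Qed.

(* Equality holds: this is Cayley's formula for rooted forests *)
Lemma card_parent_funs_ge A B : [disjoint A & B] ->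
  #|B| * (#|A| + #|B|) ^ #|A| <= (#|A| + #|B|) * #|parent_funs A B|.
Proof.
have [m] := ubnP #|A|; elim: m A B => // m IH A B Am dAB.
have [A0|A0] := posnP #|A|.
  rewrite A0 expn0 muln1 add0n leq_pmulr //; apply/card_gt0P.
  exists [ffun v => v]; rewrite inE; apply/asboolP; split=> [v|v _|].
  - by move=> vA; move: A0; rewrite (cardsD1 v) vA.
  - by rewrite ffunE.
  by exists (fun=> 0) => v vA; move: A0; rewrite (cardsD1 v) vA.
(* The forests on A minus C rooted at C have |A| vertices in all, so the induction hypothesis
   carries a factor |A|; the claim is multiplied by it. An empty C contributes 0 to the left
   side. *)
suff H : #|A| * (#|B| * (#|A| + #|B|) ^ #|A|.-1) <= #|A| * #|parent_funs A B|.
  rewrite leq_pmul2l // in H.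
  by rewrite -{2}(prednK A0) expnS mulnCA leq_mul2l H orbT.
rewrite -sum_bin_mul_expn -(sum_subset_card A (fun j => #|B| ^ j * (j * #|A| ^ (#|A| - j)))).
have -> : #|parent_funs A B| = \sum_(C : {set V} | C \subset A)
    #|[set f in parent_funs A B | [set v in A | f v \in B] == C]|.
  rewrite -sum1_card (partition_big (fun f : {ffun V -> V} => [set v in A | f v \in B])
    (fun C : {set V} => C \subset A)) /=.
    by apply: eq_bigr => C CA; rewrite -sum1_card; apply: eq_bigl => f; rewrite inE.
  by move=> f _; apply/subsetP => v; rewrite inE => /andP[].
rewrite big_distrr /=; apply: leq_sum => C CA.
apply: leq_trans (leq_mul (leqnn _) (card_parent_funs_children dAB CA)).
rewrite [leqRHS]mulnCA leq_mul2l; apply/orP; right.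
have cAC : #|A :\: C| = #|A| - #|C| by rewrite cardsDS.
have CleA := subset_leq_card CA.
have [C0|C0] := posnP #|C|; first by rewrite C0.
have := IH (A :\: C) C; rewrite cAC subnK //; apply; first lia.
by rewrite disjoint_sym disjoints_subset; apply/subsetP => v vC; rewrite !inE vC.
Qed.

(** Unlike in [edges_of], the root is left out: a parent function fixes it and would yield a
    singleton. *)
Definition rooted_edges (r : V) (f : {ffun V -> V}) : {set {set V}} :=
  [set [set v; f v] | v in [set~ r]].

Lemma adj_rooted_edges r f x y : adj (rooted_edges r f) x y ->
  x != r /\ y = f x \/ y != r /\ x = f y.
Proof.
case/imsetP => v; rewrite !inE => vr e.
have xv : (x == v) || (x == f v) by have := set21 x y; rewrite e !inE.
have yv : (y == v) || (y == f v) by have := set22 x y; rewrite e !inE.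
have vx : (v == x) || (v == y) by have := set21 v (f v); rewrite -e !inE.
have fx : (f v == x) || (f v == y) by have := set22 v (f v); rewrite -e !inE.
case/orP: xv => /eqP xE; case/orP: yv => /eqP yE.
- by left; rewrite xE; split=> //; case/orP: fx => /eqP; congruence.
- by left; rewrite xE.
- by right; rewrite yE.
- by left; case/orP: vx => /eqP vE; rewrite -?vE; split=> //; congruence.
Qed.

(** Following parents leads to r, whence connectedness. On a cycle, both neighbours of a deepest
    vertex would have to be its parent. *)
Lemma rooted_edges_tree r f : parent_fun [set~ r] [set r] f -> is_tree (rooted_edges r f).
Proof.
case=> _ _ [d fd].
have dlt v : v != r -> d (f v) < d v by move=> vr; apply: fd; rewrite !inE.
have fE v : v != r -> adj (rooted_edges r f) v (f v).
  by move=> vr; apply: imset_f; rewrite !inE.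
apply/and3P; split.
- apply/forall_inP => _ /imsetP[v + ->]; rewrite !inE => vr; rewrite cards2.
  by case: (eqVneq v (f v)) => [vf|//]; have := dlt v vr; rewrite -vf ltnn.
- apply/andP; split; first by apply/card_gt0P; exists r.
  have cr v : connect (adj (rooted_edges r f)) v r.
    have [m] := ubnP (d v); elim: m v => // m IH v dv.
    have [->//|vr] := eqVneq v r.
    apply: connect_trans (connect1 (fE _ vr)) _; apply: IH.
    exact: leq_trans (dlt _ vr) _.
  apply/forallP => x; apply/forallP => y; apply: connect_trans (cr x) _.
  by rewrite (@sym_connect_sym _ (adj _)) // => a b; apply: adjC.
apply/acyclicP => c c3 /andP[cyc uc].
have [v0 v0c] : exists v, v \in c by case: c c3 {cyc uc} => // v c _; exists v; rewrite mem_head.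
have [v vc vmax] : exists2 v, v \in c & forall w, w \in c -> d w <= d v.
  by case: (arg_maxnP d v0c) => v vc H; exists v.
have nbr w : w \in c -> adj (rooted_edges r f) v w -> w = f v.
  move=> wc /adj_rooted_edges[[_ ->]//|[wr vf]].
  by have := dlt _ wr; rewrite -vf ltnNge vmax.
case: (rot_to vc) => i s sE.
have : cycle (adj (rooted_edges r f)) (v :: s) by rewrite -sE rot_cycle.
have us : uniq (v :: s) by rewrite -sE rot_uniq.
have sc w : w \in v :: s -> w \in c by rewrite -sE mem_rot.
have : 2 < size (v :: s) by rewrite -sE size_rot.
case: s {sE} us sc => [//|w [//|w' s]] us sc _ /=.
rewrite rcons_path /= => /and4P[vw _ _ lv].
have wf : w = f v by apply: nbr; rewrite // sc // !inE eqxx orbT.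
have lf : last w' s = f v.
  apply: nbr; last by rewrite adjC.
  by apply: sc; rewrite in_cons in_cons mem_last !orbT.
have : w \in w' :: s by rewrite wf -lf mem_last.
by case/and3P: us => _ /negP.
Qed.

(** Induction on the depth for f. If f v differs from g v, then g (f v) = v; by induction f (f v) =
    v, which contradicts the decrease of depth. *)
Lemma rooted_edges_inj r :
  {in parent_funs [set~ r] [set r] &, injective (rooted_edges r)}.
Proof.
move=> f g; rewrite !inE => /asboolP[_ fr [d fd]] /asboolP[_ gr _] efg.
apply/ffunP => v; have [m] := ubnP (d v); elim: m v => // m IH v dv.
have [vr|vr] := eqVneq v r; first by rewrite fr ?gr // !inE vr eqxx.
have dlt w : w != r -> d (f w) < d w by move=> wr; apply: fd; rewrite !inE.
have : adj (rooted_edges r g) v (f v).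
  by rewrite -efg; apply: imset_f; rewrite !inE.
case/adj_rooted_edges => [[]//|[fvr vE]].
have := IH _ (leq_trans (dlt _ vr) dv); rewrite -vE => ffv.
by have := dlt _ fvr; rewrite ffv ltnNge ltnW ?dlt.
Qed.

(** Cayley's bound n^(n - 2), multiplied by n^2 to avoid the subtraction: the case of forests with
    the single root r. *)
Lemma card_trees_ge (r : V) : #|V| ^ #|V| <= #|V| ^ 2 * #|trees V|.
Proof.
have dr : [disjoint [set~ r] & [set r]].
  by rewrite disjoints_subset; apply/subsetP => v; rewrite !inE.
have := card_parent_funs_ge dr; rewrite cards1 mul1n.
have Vr : #|[set~ r]| + 1 = #|V| by rewrite -(cardsC [set r]) cards1 addnC.
rewrite Vr => H.
rewrite -[in X in _ ^ X <= _]Vr expnD expn1 mulnC -mulnn -mulnA leq_mul2l; apply/orP; right.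
apply: leq_trans H _; rewrite leq_mul2l; apply/orP; right.
rewrite -(card_in_imset (@rooted_edges_inj r)); apply: subset_leq_card.
apply/subsetP => _ /imsetP[f + ->]; rewrite !inE => /asboolP.
exact: rooted_edges_tree.
Qed.

End CayleyLowerBound.

(** * Bounds on the number of trees with X_{k+1} > X_k *)

Section Bounds.
Variable n : nat.
Hypothesis n_gt1 : 1 < n.

Definition increasing_trees k :=
  [set T in trees 'I_n | num_independent T k < num_independent T k.+1].

(** With u = k, the factor 'C(n - k, k) on the right of [card_increasing] vanishes. *)
Lemma increasing_trees_eq0 k : n < k.*2 -> #|increasing_trees k| = 0.
Proof.
move=> nk; have := @card_increasing 'I_n k k; rewrite card_ord => /(_ n_gt1 (leqnn _)).
rewrite binn (@bin_small (n - k)); last by lia.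
rewrite muln0 mul0n muln0 muln1 leqn0 muln_eq0 => /orP[/eqP //|/eqP]; lia.
Qed.

(** The choice u = k: the number 'C(n - k, k) of sets U cancels against the lower bound on X_k. *)
Lemma card_increasing_half k : k.*2 <= n ->
  #|increasing_trees k| * (k ^ k * (n - k) ^ (n - k.*2)) <=
  n * n ^ n * ((n - k.*2) ^ k * n ^ (n - k.*2)).
Proof.
move=> nk; have := @card_increasing 'I_n k k; rewrite card_ord => /(_ n_gt1 (leqnn _)).
have B0 : 0 < 'C(n - k, k) by rewrite bin_gt0; lia.
rewrite binn muln1 -/(increasing_trees k) => H.
have {}H : #|increasing_trees k| <= n * ('C(n, k) *
    ((n - k.*2) ^ k * (n - k) ^ k * n ^ (n - k.*2))).
  rewrite -(leq_pmul2r B0); apply: leq_trans (leq_trans H _).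
    by rewrite leq_mul2l (leq_trans _ (leq_maxr _ _)) ?orbT // leq_bin2l //; lia.
  by rewrite -subnDA addnn; apply: eq_leq; ring.
(* This is one term of the expansion of ((n - k) + k)^n. *)
have Cn : 'C(n, k) * ((n - k) ^ (n - k) * k ^ k) <= n ^ n.
  rewrite -[X in _ <= X ^ _](@subnK k n); last lia.
  rewrite expnDn (bigD1 (inord k)) //= inordK; last lia.
  exact: leq_addr.
have [nk0|nk0] := posnP (n - k).
  by exfalso; lia.
rewrite -(@leq_pmul2r ((n - k) ^ k)) ?expn_gt0 ?nk0 //.
have -> : #|increasing_trees k| * (k ^ k * (n - k) ^ (n - k.*2)) * (n - k) ^ k =
    #|increasing_trees k| * ((n - k) ^ (n - k) * k ^ k).
  rewrite (_ : (n - k) ^ (n - k) = (n - k) ^ (n - k.*2) * (n - k) ^ k); first ring.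
  by rewrite -expnD; congr (_ ^ _); lia.
apply: leq_trans (leq_mul H (leqnn _)) _.
apply: leq_trans (_ : _ <= n * ((n - k.*2) ^ k * (n - k) ^ k * n ^ (n - k.*2)) * n ^ n) _; last first.
  by apply: eq_leq; ring.
by apply: leq_trans (leq_mul (leqnn _) Cn); apply: eq_leq; ring.
Qed.

(** The bound of [card_increasing] with 'C(n - k, k) for X_k, its binomial coefficients written out
    and cancelled, is n n! [bound_num] / [bound_den]. *)
Definition bound_num u k :=
  (k - u)`! * (n - k.*2)`! * ((n - k - u) ^ k * (n - k) ^ u * n ^ (n - k - u)).
Definition bound_den u k := k`! * (n - k - u)`! * (n - k)`!.

Lemma card_increasing_fact u k : u <= k -> k.*2 <= n ->
  #|increasing_trees k| * bound_den u k <= n * n`! * bound_num u k.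
Proof.
move=> uk nk; have := @card_increasing 'I_n k u; rewrite card_ord => /(_ n_gt1 uk).
rewrite -/(increasing_trees k) => H.
have {}H : #|increasing_trees k| * ('C(n - k, k) * 'C(k, u)) <= n * ('C(n, k) * 'C(n - k, u) *
   ((n - k - u) ^ k * (n - k) ^ u * n ^ (n - k - u))).
  apply: leq_trans H; rewrite mulnA leq_mul2r; apply/orP; right.
  rewrite leq_mul2l; apply/orP; right; apply: leq_trans (leq_maxr _ _).
  by apply: leq_bin2l; lia.
have E1 := @bin_fact (n - k) k; have E2 := bin_fact uk.
have E3 := @bin_fact n k; have E4 := @bin_fact (n - k) u.
rewrite /bound_den /bound_num; set M := (X in _ <= n * n`! * (_ * X)) in H *.
have {}E1 : 'C(n - k, k) * (k`! * (n - k.*2)`!) = (n - k)`!.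
  by rewrite -E1 -?subnDA ?addnn //; lia.
have {}E3 : 'C(n, k) * (k`! * (n - k)`!) = n`! by apply: E3; lia.
have {}E4 : 'C(n - k, u) * (u`! * (n - k - u)`!) = (n - k)`! by apply: E4; lia.
have K0 : 0 < u`! by apply: fact_gt0.
have K1 : 0 < (n - k)`! by apply: fact_gt0.
rewrite -(leq_pmul2r K0) -(leq_pmul2r K1).
rewrite (_ : _ * u`! * (n - k)`! = #|increasing_trees k| * ('C(n - k, k) * 'C(k, u)) *
   ((k - u)`! * (n - k.*2)`! * k`! * (n - k - u)`! * (u`! * u`! * (n - k)`!))); last first.
  rewrite -{1}E1 -E2; ring.
rewrite [leqRHS](_ : _ = (n * ('C(n, k) * 'C(n - k, u) * M)) *
   ((k - u)`! * (n - k.*2)`! * k`! * (n - k - u)`! * (u`! * u`! * (n - k)`!))); last first.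
  rewrite -{1}E3 -{2}E4; ring.
by rewrite leq_mul2r H orbT.
Qed.

(** The quotient [bound_num] / [bound_den] does not increase from k to k+1. The last hypothesis
    bounds the ratio of the two quotients, after n - k - 1 - u and n - k - 1 in the bases of powers
    are raised by 1. *)
Lemma bound_step u k : u <= k -> k.+1.*2 <= n -> k.+1 + u <= n ->
  (k.+1 - u) * (n - k - u) ^ 2 * (n - k) <= (n - k.*2) * (n - k.*2).-1 * n * k.+1 ->
  bound_num u k.+1 * bound_den u k <= bound_num u k * bound_den u k.+1.
Proof.
move=> uk nk ku H; rewrite /bound_num /bound_den.
rewrite (_ : k.+1 - u = (k - u).+1); last lia.
rewrite (_ : k.+1.*2 = k.*2.+2); last lia.
have Eq : n - k.*2 = (n - k.*2.+2).+2 by lia.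
have Er : n - k - u = (n - k.+1 - u).+1 by lia.
have Em : n - k = (n - k.+1).+1 by lia.
move: H; rewrite Eq Er Em (_ : k.+1 - u = (k - u).+1); last lia.
move: (k - u) (n - k.+1) (n - k.+1 - u) (n - k.*2.+2) => w m r q {Eq Er Em nk ku uk} /= H.
rewrite !factS !expnS.
have le_exp x e : x ^ e <= x.+1 ^ e by case: e => // e; rewrite leq_exp2r.
set K := w`! * q`! * r.+1 ^ k * m.+1 ^ u * n ^ r * k`! * r`! * m`!.
apply: (@leq_trans (w.+1 * r.+1 ^ 2 * m.+1 * K)).
  apply: (@leq_trans (w.+1 * (r * r ^ k * m ^ u) * r.+1 * m.+1 *
      (w`! * q`! * n ^ r * k`! * r`! * m`!))); first by apply: eq_leq; ring.
  apply: (@leq_trans (w.+1 * (r.+1 * r.+1 ^ k * m.+1 ^ u) * r.+1 * m.+1 *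
      (w`! * q`! * n ^ r * k`! * r`! * m`!))); last by apply: eq_leq; rewrite /K; ring.
  by do ![apply: leq_mul => //].
apply: (@leq_trans (q.+2 * q.+1 * n * k.+1 * K)); first by rewrite leq_mul2r H orbT.
by apply: eq_leq; rewrite /K; ring.
Qed.

End Bounds.

(** * Monotonicity of the bound up to k = 0.39 n *)

Local Open Scope ring_scope.

(** By homogeneity only x = K / N matters, which leaves a cubic inequality on the interval from
    0.346 to 0.39. *)
Lemma cubic_ineq (F : realFieldType) (N K : F) : 0 <= N -> 346 / 1000 * N <= K -> K <= 390 / 1000 * N ->
  45 / 100 * (782 / 1000 * N - K) ^+ 2 * (N - K) <= 99 / 100 * (N - 2 * K) ^+ 2 * N.
Proof.
move=> N0 K0 K1.
have [->|Nn0] := eqVneq N 0; first nra.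
have Np : 0 < N by rewrite lt_neqAle eq_sym Nn0.
pose x := K / N; have Kx : K = x * N by rewrite /x divfK.
have x0 : 346 / 1000 <= x by rewrite /x ler_pdivlMr.
have x1 : x <= 390 / 1000 by rewrite /x ler_pdivrMr.
rewrite Kx.
have H : 0 <= 99 / 100 * (1 - 2 * x) ^+ 2 - 45 / 100 * (782 / 1000 - x) ^+ 2 * (1 - x) by nra.
rewrite -subr_ge0; move: (mulr_ge0 H (exprn_ge0 3 N0)).
suff -> : 99 / 100 * (N - 2 * (x * N)) ^+ 2 * N -
    45 / 100 * (782 / 1000 * N - x * N) ^+ 2 * (N - x * N) =
  (99 / 100 * (1 - 2 * x) ^+ 2 - 45 / 100 * (782 / 1000 - x) ^+ 2 * (1 - x)) * N ^+ 3 by [].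
by ring.
Qed.

Lemma quartic_ineq (F : realFieldType) (N K U : F) :
  2000 <= N -> N * 82 + 1 <= (U + 1) * 375 -> U * 375 <= N * 82 ->
  N * 130 + 1 <= (K + 1) * 375 -> 100 * (K + 1) <= 39 * N ->
  (K + 1 - U) * (N - K - U) ^+ 2 * (N - K) <= (N - 2 * K) * (N - 2 * K - 1) * N * (K + 1).
Proof.
move=> N15 U1 U0 K0 K1.
(* Rounded constants: 1 - U / (K + 1) is largest at K + 1 = 0.39 N, where it is below 0.45; 0.782
   exceeds 1 - 82 / 375 = 0.7813...; 0.99 absorbs the -1. The floors are absorbed because N >=
   2000. *)
have a1 : K + 1 - U <= 45 / 100 * (K + 1) by lra.
have a0 : 0 <= K + 1 - U by lra.
have a2 : N - K - U <= 782 / 1000 * N - K by lra.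
have a3 : 99 / 100 * (N - 2 * K) <= N - 2 * K - 1 by lra.
have a4 : 45 / 100 * (782 / 1000 * N - K) ^+ 2 * (N - K) <= 99 / 100 * (N - 2 * K) ^+ 2 * N.
  by apply: cubic_ineq; lra.
have Kp : 0 <= K + 1 by lra.
have Mp : 0 <= N - K by lra.
have Np : 0 <= N by lra.
have Qp : 0 <= N - 2 * K by lra.
have Rp : 0 <= N - K - U by lra.
move: a1 a0 a2 a3 a4 Rp Mp Kp Qp Np.
move: (45 / 100) (99 / 100) (782 / 1000 * N - K) => c1 c2 B.
move: (N - 2 * K) (K + 1) (N - K - U) => q k1 r.
move: (N - K) => m {N15 U1 U0 K0 K1}.
move: (k1 - U) => w w1 w0 rB qq a4 r0 m0 k0 q0 N0.
have H1 : w * r ^+ 2 * m <= c1 * k1 * B ^+ 2 * m.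
  apply: ler_wpM2r => //; apply: ler_pM; rewrite ?sqr_ge0 //.
  by rewrite ler_sqr ?nnegrE //; exact: le_trans r0 rB.
apply: le_trans H1 _.
have H2 := ler_wpM2r k0 a4.
have H3 := ler_wpM2r (mulr_ge0 N0 k0) (ler_wpM2l q0 qq).
rewrite (_ : c1 * k1 * B ^+ 2 * m = c1 * B ^+ 2 * m * k1); last by ring.
apply: le_trans H2 _.
rewrite (_ : c2 * q ^+ 2 * N * k1 = q * (c2 * q) * (N * k1)); last by ring.
by rewrite -[leRHS]mulrA.
Qed.

Lemma bound_step_cond (n k u : nat) : (2000 <= n)%N ->
  (n * 82 < u.+1 * 375)%N -> (u * 375 <= n * 82)%N ->
  (n * 130 < k.+1 * 375)%N -> (100 * k.+1 <= 39 * n)%N ->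
  ((k.+1 - u) * (n - k - u) ^ 2 * (n - k) <= (n - k.*2) * (n - k.*2).-1 * n * k.+1)%N.
Proof.
move=> n15 U1 U0 K0 K1.
have [kn ukn uk] : [/\ k.*2 < n, u + k <= n & u <= k.+1]%N by split; lia.
rewrite -mulnn -(ler_nat rat) !natrM -subn1 !natrB //; try lia.
rewrite -mul2n !natrM -(natr1 k) -expr2.
move: n15 U1 U0 K0 K1; rewrite -!(ler_nat rat) -(natr1 (n * 82)) -(natr1 (n * 130)) !natrM -(natr1 k) -(natr1 u).
exact: quartic_ineq.
Qed.

Lemma bound_mono (n k0 k u : nat) : (2000 <= n)%N ->
  (n * 82 < u.+1 * 375)%N -> (u * 375 <= n * 82)%N ->
  (n * 130 < k0.+1 * 375)%N -> (k0 <= k)%N -> (100 * k <= 39 * n)%N ->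
  (bound_num n u k * bound_den n u k0 <= bound_num n u k0 * bound_den n u k)%N.
Proof.
move=> n15 U1 U0 K0 + K1; elim: k K1 => [|k IH] K1; first by rewrite leqn0 => /eqP ->.
rewrite leq_eqVlt => /orP[/eqP <- //|]; rewrite ltnS => k0k.
have {}IH := IH (leq_trans (leq_mul (leqnn 100) (leqnSn k)) K1) k0k.
have c := bound_step_cond n15 U1 U0 (leq_trans K0 (leq_mul (k0k : (k0.+1 <= k.+1)%N) (leqnn 375))) K1.
have S : (bound_num n u k.+1 * bound_den n u k <= bound_num n u k * bound_den n u k.+1)%N.
  by apply: bound_step => //; lia.
have D0 : (0 < bound_den n u k)%N by rewrite !muln_gt0 !fact_gt0.
rewrite -(leq_pmul2r D0) mulnAC; apply: leq_trans (leq_mul S (leqnn _)) _.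
by rewrite mulnAC; apply: leq_trans (leq_mul IH (leqnn _)) _; rewrite mulnAC.
Qed.

(** * Asymptotics *)

From mathcomp Require Import all_classical all_reals all_analysis.
Import numFieldNormedType.Exports.
Local Open Scope classical_set_scope.

(* The margin is small: the two sides differ by a factor 1.0046 *)
Lemma powers_lt :
  (48 ^ 48 * (115 ^ 115 * 375 ^ 163) < 130 ^ 130 * (163 ^ 33 * 245 ^ 163))%N.
Proof. lia. Qed.

Section Estimates.
Variable R : realType.
Implicit Types x y : R.

Lemma ln_sub_le x y : 0 < x -> 0 < y -> ln y - ln x <= (y - x) / x.
Proof.
move=> x0 y0; rewrite -ln_div ?posrE //.
rewrite (_ : y / x = 1 + (y - x) / x); last by field; rewrite gt_eqF.
apply: le_ln1Dx; rewrite mulrBl divff ?gt_eqF // ltrBrDl subrr.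
by rewrite divr_gt0.
Qed.

(** With [ln_fact_le], Stirling's formula up to a factor e m. Such polynomial losses are harmless
    against a negative exponential rate. *)
Lemma ln_fact_ge (m : nat) : (0 < m)%N -> m%:R * ln m%:R - m%:R <= ln m`!%:R :> R.
Proof.
case: m => // m _; elim: m => [|m IH]; first by rewrite factS fact0 mul1n ln1; lra.
have m1 : 0 < m.+1%:R :> R by rewrite ltr0n.
have m2 : 0 < m.+2%:R :> R by rewrite ltr0n.
have f0 : 0 < (m.+1)`!%:R :> R by rewrite ltr0n fact_gt0.
rewrite factS natrM lnM ?posrE //.
have := ln_sub_le m1 m2.
rewrite (_ : m.+2%:R - m.+1%:R = 1 :> R); last by rewrite -(natr1 m.+1) addrC addKr.
rewrite ler_pdivlMr // => H.
have E : m.+2%:R = m.+1%:R + 1 :> R by rewrite -natr1.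
move: H IH; move: (ln m.+2%:R) (ln m.+1%:R) (ln (m.+1)`!%:R) => a b c; rewrite E; lra.
Qed.

Lemma ln_fact_le (m : nat) : (0 < m)%N ->
  ln m`!%:R <= m%:R * ln m%:R - m%:R + ln m%:R + 1 :> R.
Proof.
case: m => // m _; elim: m => [|m IH]; first by rewrite factS fact0 mul1n ln1; lra.
have m1 : 0 < m.+1%:R :> R by rewrite ltr0n.
have m2 : 0 < m.+2%:R :> R by rewrite ltr0n.
have f0 : 0 < (m.+1)`!%:R :> R by rewrite ltr0n fact_gt0.
rewrite factS natrM lnM ?posrE //.
have := ln_sub_le m2 m1.
rewrite (_ : m.+1%:R - m.+2%:R = - 1 :> R); last by rewrite -(natr1 m.+1) opprD addrA subrr add0r.
rewrite ler_pdivlMr // => H.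
have E : m.+2%:R = m.+1%:R + 1 :> R by rewrite -natr1.
move: H IH; move: (ln m.+2%:R) (ln m.+1%:R) (ln (m.+1)`!%:R) => a b c; rewrite E; lra.
Qed.

(* The exponential rate of n`! * bound_num n u k / (bound_den n u k * n ^ n)
   for k = x n and u = y n *)
Definition rate x y : R :=
  (x - y) * ln (x - y) + (1 - 2 * x) * ln (1 - 2 * x)
  + x * ln (1 - x - y) + y * ln (1 - x)
  - x * ln x - (1 - x - y) * ln (1 - x - y) - (1 - x) * ln (1 - x).

(** The linear terms of Stirling's formula cancel. The three factorials in the numerator each cost
    an error of at most ln n + 1. *)
Lemma ln_bound_le (n u k : nat) : (u < k)%N -> (k.*2 < n)%N ->
  ln (n`! * bound_num n u k)%:R - ln (bound_den n u k)%:R <=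
  n%:R * ln n%:R + n%:R * rate (k%:R / n%:R) (u%:R / n%:R) + 3 * (ln n%:R + 1) :> R.
Proof.
move=> uk kn.
have n0 : (0 < n)%N by lia.
have [w0 q0 r0 k0 m0] : [/\ 0 < k - u, 0 < n - k.*2, 0 < n - k - u, 0 < k & 0 < n - k]%N by split; lia.
have Ew : (k - u)%:R = k%:R - u%:R :> R by rewrite natrB //; lia.
have Em : (n - k)%:R = n%:R - k%:R :> R by rewrite natrB //; lia.
have Er : (n - k - u)%:R = n%:R - k%:R - u%:R :> R by rewrite !natrB //; lia.
have Eq : (n - k.*2)%:R = n%:R - 2 * k%:R :> R.
  by rewrite natrB -?mul2n ?natrM //; lia.
have lnD j : (0 < j)%N -> ln (j%:R / n%:R) = ln j%:R - ln n%:R :> R.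
  by move=> j0; rewrite ln_div ?posrE ?ltr0n.
have nn0 : n%:R != 0 :> R by rewrite pnatr_eq0; lia.
have -> : n%:R * rate (k%:R / n%:R) (u%:R / n%:R) =
  (k - u)%:R * (ln (k - u)%:R - ln n%:R) + (n - k.*2)%:R * (ln (n - k.*2)%:R - ln n%:R)
  + k%:R * (ln (n - k - u)%:R - ln n%:R) + u%:R * (ln (n - k)%:R - ln n%:R)
  - k%:R * (ln k%:R - ln n%:R) - (n - k - u)%:R * (ln (n - k - u)%:R - ln n%:R)
  - (n - k)%:R * (ln (n - k)%:R - ln n%:R).
  rewrite -!lnD // Ew Eq Er Em /rate.
  rewrite (_ : k%:R / n%:R - u%:R / n%:R = (k%:R - u%:R) / n%:R); last by field.
  rewrite (_ : 1 - 2 * (k%:R / n%:R) = (n%:R - 2 * k%:R) / n%:R); last by field.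
  rewrite (_ : 1 - k%:R / n%:R - u%:R / n%:R = (n%:R - k%:R - u%:R) / n%:R); last by field.
  rewrite (_ : 1 - k%:R / n%:R = (n%:R - k%:R) / n%:R); last by field.
  by field.
have pw (a e : nat) : (0 < a)%N -> ln ((a ^ e)%N%:R) = e%:R * ln a%:R :> R.
  by move=> a0; rewrite natrX lnXn ?ltr0n // mulr_natl.
have lnMn (a b : nat) : (0 < a)%N -> (0 < b)%N -> ln ((a * b)%N%:R) = ln a%:R + ln b%:R :> R.
  by move=> a0 b0; rewrite natrM lnM ?posrE ?ltr0n.
rewrite /bound_num /bound_den !lnMn ?(muln_gt0, fact_gt0, expn_gt0, n0, w0, q0, r0, k0, m0) // !pw //.
have := ln_fact_le n0; have := ln_fact_le w0; have := ln_fact_le q0.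
have := ln_fact_ge k0; have := ln_fact_ge r0; have := ln_fact_ge m0.
have lnle j : (0 < j)%N -> (j <= n)%N -> ln j%:R <= ln n%:R :> R.
  by move=> j0 jn; rewrite ler_ln ?posrE ?ltr0n // ler_nat.
have := lnle _ w0; have := lnle _ q0.
move=> /(_ (leq_subr _ _)) lq /(_ _) lw.
have {}lw : ln (k - u)%:R <= ln n%:R :> R by apply: lw; lia.
move: lq lw; rewrite Ew Eq Er Em.
move: (ln n%:R) (ln (_ - _)) (ln (_ - _)) (ln (_ - _)) (ln (_ - _)) (ln k%:R) => *.
lra.
Qed.

Lemma ln_expn_lt (a b c d e f i j k l m p : nat) :
  (0 < a)%N -> (0 < b)%N -> (0 < c)%N -> (0 < d)%N -> (0 < e)%N -> (0 < f)%N ->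
  (a ^ i * (b ^ j * c ^ k) < d ^ l * (e ^ m * f ^ p))%N ->
  i%:R * ln a%:R + (j%:R * ln b%:R + k%:R * ln c%:R) <
  l%:R * ln d%:R + (m%:R * ln e%:R + p%:R * ln f%:R) :> R.
Proof.
move=> a0 b0 c0 d0 e0 f0; rewrite -(ltr_nat R) !natrM !natrX => H.
have xp (x y : nat) : (0 < x)%N -> 0 < x%:R ^+ y :> R.
  by move=> x0; rewrite exprn_gt0 // ltr0n.
have lnP (x y z i' j' k' : nat) : (0 < x)%N -> (0 < y)%N -> (0 < z)%N ->
    ln (x%:R ^+ i' * (y%:R ^+ j' * z%:R ^+ k')) =
    i'%:R * ln x%:R + (j'%:R * ln y%:R + k'%:R * ln z%:R) :> R.
  move=> x0 y0 z0; rewrite lnM ?posrE ?mulr_gt0 ?xp //.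
  by rewrite lnM ?posrE ?xp // !lnXn ?ltr0n // !mulr_natl.
by rewrite -!lnP // ltr_ln ?posrE ?mulr_gt0 ?xp.
Qed.

(** Scaled to n = s, the numbers a, b, c, d, e are k - u, n - 2k, n - k - u, k, n - k. Then s times
    the rate is the left side of the last inequality minus its right side. *)
Lemma rate_lt0_of (s a b c d e p q t : R) :
  0 < s -> 0 < a -> 0 < b -> 0 < c -> 0 < d -> 0 < e ->
  s - 2 * d = b -> s - 2 * d + a = c -> s - d = e ->
  p = c + e - b - d -> q = c - d -> t = e - d + a ->
  a * ln a + (b * ln b + p * ln s) < d * ln d + (q * ln c + t * ln e) ->
  rate (d / s) ((d - a) / s) < 0.
Proof.
move=> s0 a0 b0 c0 d0 e0 Eb Ec Ee -> -> -> H.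
have sn0 : s != 0 by rewrite gt_eqF.
have lq x : 0 < x -> ln (x / s) = ln x - ln s by move=> x0; rewrite ln_div.
rewrite -(pmulr_rlt0 _ s0) /rate.
rewrite (_ : d / s - (d - a) / s = a / s); last by field.
rewrite (_ : 1 - 2 * (d / s) = b / s); last by rewrite -Eb; field.
rewrite (_ : 1 - d / s - (d - a) / s = c / s); last by rewrite -Ec; field.
rewrite (_ : 1 - d / s = e / s); last by rewrite -Ee; field.
rewrite !lq //; rewrite -subr_lt0 in H; apply: le_lt_trans H.
rewrite le_eqVlt; apply/orP; left; apply/eqP.
move: (ln a) (ln b) (ln c) (ln d) (ln e) (ln s) => la lb lc ld le ls.
by rewrite -Ec -Ee -Eb; field.
Qed.

Lemma rate_lt0 : rate (130 / 375) ((130 - 48) / 375) < 0.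
Proof.
have H : 48 * ln 48 + (115 * ln 115 + 163 * ln 375) < 130 * ln 130 + (33 * ln 163 + 163 * ln 245) :> R.
  exact: (ln_expn_lt _ _ _ _ _ _ powers_lt).
by apply: (rate_lt0_of _ _ _ _ _ _ _ _ _ _ _ _ H); rewrite ?ltr0n //; lra.
Qed.

Lemma cvg_floor_ratio (a b : nat) : (0 < b)%N ->
  (n * a %/ b)%:R / n%:R @[n --> \oo] --> (a%:R / b%:R : R).
Proof.
move=> b0.
have b0R : 0 < b%:R :> R by rewrite ltr0n.
(* The floor costs at most 1 / n, and [harmonic n] is 1 / (n + 1), hence the factor 2. *)
apply: (@squeeze_cvgr _ _ _ _ (fun n => a%:R / b%:R - 2 * harmonic n) (fun=> a%:R / b%:R)); last 2 first.
- rewrite -[X in _ --> X]subr0; apply: cvgB; first exact: cvg_cst.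
  by rewrite -[X in _ --> X](mulr0 2); apply: cvgMr; apply: cvg_harmonic.
- exact: cvg_cst.
near=> n.
have n0 : (0 < n)%N by near: n; exact: nbhs_infty_ge.
have n0R : 0 < n%:R :> R by rewrite ltr0n.
have h2 : n%:R^-1 <= 2 * harmonic n :> R.
  rewrite /harmonic ler_pdivlMr ?ltr0n // mulrC ler_pdivrMr // -natrM ler_nat; lia.
have := leq_trunc_div (n * a) b; rewrite -(ler_nat R) !natrM => H1.
have := ltn_ceil (n * a) b0; rewrite -(ltr_nat R) !natrM -natr1 => H2.
apply/andP; split; last by rewrite ler_pdivrMr // mulrAC ler_pdivlMr // [_ * n%:R]mulrC.
apply: (@le_trans _ _ (a%:R / b%:R - n%:R^-1)); first by rewrite lerD2l lerN2.
rewrite ler_pdivlMr // mulrBl mulVf ?gt_eqF // lerBlDr mulrAC ler_pdivrMr // [_ * n%:R]mulrC.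
exact: ltW.
Unshelve. all: by end_near.
Qed.

Lemma cvg_rate (x y : nat -> R) (a b : R) :
  0 < a - b -> 0 < 1 - 2 * a -> 0 < 1 - a - b -> 0 < 1 - a -> 0 < a ->
  x n @[n --> \oo] --> a -> y n @[n --> \oo] --> b ->
  rate (x n) (y n) @[n --> \oo] --> rate a b.
Proof.
move=> h1 h2 h3 h4 h5 xa yb.
have lnc (z : nat -> R) (c : R) : 0 < c -> z n @[n --> \oo] --> c ->
    ln (z n) @[n --> \oo] --> ln c.
  by move=> c0 zc; apply: continuous_cvg => //; apply: continuous_ln.
have c1 : (1 : R) @[n --> \oo] --> (1 : R) by exact: cvg_cst.
have e1 : x n - y n @[n --> \oo] --> a - b by apply: cvgB.
have e2 : 1 - 2 * x n @[n --> \oo] --> 1 - 2 * a.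
  by apply: cvgB => //; apply: cvgMr.
have e3 : 1 - x n - y n @[n --> \oo] --> 1 - a - b by apply: cvgB => //; apply: cvgB.
have e4 : 1 - x n @[n --> \oo] --> 1 - a by apply: cvgB.
rewrite /rate.
apply: cvgB (cvgM e4 (lnc _ _ h4 e4)).
apply: cvgB (cvgM e3 (lnc _ _ h3 e3)).
apply: cvgB (cvgM xa (lnc _ _ h5 xa)).
apply: cvgD (cvgM yb (lnc _ _ h4 e4)).
apply: cvgD (cvgM xa (lnc _ _ h3 e3)).
exact: cvgD (cvgM e1 (lnc _ _ h1 e1)) (cvgM e2 (lnc _ _ h2 e2)).
Qed.

(** Since exp(t) >= t^(m + 1) / (m + 1)!, the sequence is O(1 / n). *)
Lemma cvg_expn_expR (m : nat) (c d : R) : 0 < d ->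
  c * n%:R ^+ m * expR (- (d * n%:R)) @[n --> \oo] --> (0 : R).
Proof.
move=> d0.
pose C := m.+1`!%:R / d ^+ m.+1.
have C0 : 0 <= C by rewrite divr_ge0 ?exprn_ge0 // ltW.
apply: norm_cvg0.
apply: (@squeeze_cvgr _ _ _ _ (fun=> 0) (fun n => 2 * (`|c| * C) * harmonic n)); last 2 first.
- exact: cvg_cst.
- by rewrite -[X in _ --> X](mulr0 (2 * (`|c| * C))); apply: cvgMr; apply: cvg_harmonic.
near=> n.
have n0 : (0 < n)%N by near: n; exact: nbhs_infty_ge.
have n0R : 0 < n%:R :> R by rewrite ltr0n.
have h2 : n%:R^-1 <= 2 * harmonic n :> R.
  rewrite /harmonic ler_pdivlMr ?ltr0n // mulrC ler_pdivrMr // -natrM ler_nat; lia.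
rewrite normr_ge0 /= -mulrA normrM [2 * _]mulrC -[leRHS]mulrA -mulrA.
apply: ler_wpM2l => //.
rewrite ger0_norm; last by rewrite mulr_ge0 ?expR_ge0 // exprn_ge0.
apply: (@le_trans _ _ (C * n%:R^-1)); last by rewrite ler_wpM2l.
have dn : 0 < d * n%:R by apply: mulr_gt0.
have := expR_ge1Dxn m (ltW dn) => H.
rewrite expRN ler_pdivrMr ?expR_gt0 //.
have {}H : (d * n%:R) ^+ m.+1 / m.+1`!%:R <= expR (d * n%:R) by apply: le_trans H; rewrite lerDr.
apply: (@le_trans _ _ (C / n%:R * ((d * n%:R) ^+ m.+1 / m.+1`!%:R))).
  have f0 : m.+1`!%:R != 0 :> R by rewrite pnatr_eq0 -lt0n fact_gt0.
  have dm0 : d ^+ m.+1 != 0 by rewrite expf_neq0 // gt_eqF.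
  rewrite /C exprMn [n%:R ^+ m.+1]exprS le_eqVlt; apply/orP; left; apply/eqP.
  by move: f0 dm0 (gt_eqF n0R) => f0 dm0 /negbT n0'; field; rewrite f0 dm0 n0'.
by rewrite ler_wpM2l // divr_ge0 // ler0n.
Unshelve. all: by end_near.
Qed.


End Estimates.

(** * Exponential decay of the proportion of bad trees *)

Section Tail.
Variable R : realType.

(** By monotonicity the least k is the worst. One factor n comes from the double counting, and e^3
    n^3 from the error 3 (ln n + 1) of Stirling's formula. *)
Lemma increasing_trees_near : exists2 d : R, 0 < d &
  \forall n \near \oo, forall k, (n * 130 %/ 375 <= k)%N -> (100 * k <= 39 * n)%N ->
    #|increasing_trees n k|%:R <= expR 3 * n%:R ^+ 4 * n%:R ^+ n * expR (- (d * n%:R)) :> R.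
Proof.
pose l : R := rate (130 / 375) ((130 - 48) / 375).
have l0 : l < 0 by apply: rate_lt0.
(* Half of the limit rate l leaves room for the floors in k and u. *)
exists (- (l / 2)); first by rewrite oppr_gt0 pmulr_llt0 // invr_gt0.
have rl : rate ((n * 130 %/ 375)%:R / n%:R) ((n * 82 %/ 375)%:R / n%:R) @[n --> \oo] --> l.
  apply: cvg_rate; try lra.
    exact: (@cvg_floor_ratio R 130 375).
  rewrite (_ : (130 - 48) / 375 = 82 / 375 :> R); last by lra.
  exact: (@cvg_floor_ratio R 82 375).
have ll : l < l / 2 by lra.
near=> n.
have n2000 : (2000 <= n)%N by near: n; exact: nbhs_infty_ge.
have rn : rate ((n * 130 %/ 375)%:R / n%:R) ((n * 82 %/ 375)%:R / n%:R) < l / 2.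
  by near: n; exact: (cvgr_lt l rl).
set k0 := (n * 130 %/ 375)%N in rn *; set u := (n * 82 %/ 375)%N in rn *.
move=> k k0k kn.
have U1 : (n * 82 < u.+1 * 375)%N by apply: ltn_ceil.
have U0 : (u * 375 <= n * 82)%N by apply: leq_trunc_div.
have K1 : (n * 130 < k0.+1 * 375)%N by apply: ltn_ceil.
have K0 : (k0 * 375 <= n * 130)%N by apply: leq_trunc_div.
have uk0 : (u < k0)%N by lia.
have k0n : (k0.*2 < n)%N by lia.
have uk : (u <= k)%N by lia.
have kn2 : (k.*2 <= n)%N by lia.
have n1 : (1 < n)%N by lia.
have F := card_increasing_fact n1 uk kn2.
have M := bound_mono n2000 U1 U0 K1 k0k kn.
have D k' : (0 < bound_den n u k')%N by rewrite !muln_gt0 !fact_gt0.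
have {F M} H : (#|increasing_trees n k| * bound_den n u k0 <= n * (n`! * bound_num n u k0))%N.
  rewrite -(leq_pmul2r (D k)) mulnAC; apply: leq_trans (leq_mul F (leqnn _)) _.
  rewrite -(mulnA (n * n`!)) [leqRHS](_ : _ = n * n`! * (bound_num n u k0 * bound_den n u k))%N.
    by rewrite leq_mul2l M orbT.
  by rewrite !mulnA.
have n0 : 0 < n%:R :> R by rewrite ltr0n ltnW.
have D0 : 0 < (bound_den n u k0)%:R :> R by rewrite ltr0n.
have A0 : (0 < n`! * bound_num n u k0)%N.
  by rewrite !(muln_gt0, fact_gt0, expn_gt0); lia.
have A0R : 0 < (n`! * bound_num n u k0)%:R :> R by rewrite ltr0n.
move: H; rewrite -(ler_nat R) natrM -ler_pdivlMr // [(n * _)%:R]natrM => /le_trans; apply.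
have L := ln_bound_le R uk0 k0n.
have nr := ler_wpM2l (ltW n0) (ltW rn).
have {}L : ln (n`! * bound_num n u k0)%:R - ln (bound_den n u k0)%:R <=
    n%:R * ln n%:R + (l / 2 * n%:R + (3%:R * ln n%:R + 3)) :> R.
  apply: le_trans L _; move: nr.
  by move: (rate _ _) (ln n%:R) => x y; lra.
have E : (n`! * bound_num n u k0)%:R / (bound_den n u k0)%:R =
    expR (ln (n`! * bound_num n u k0)%:R - ln (bound_den n u k0)%:R) :> R.
  by rewrite expRB !lnK ?posrE.
rewrite -[leLHS]mulrA E; apply: le_trans (ler_wpM2l (ltW n0) (_ : _ <= expR _)) _.
  by rewrite ler_expR; exact: L.
rewrite !expRD !expRM_natl !lnK ?posrE // mulNr opprK.
rewrite le_eqVlt; apply/orP; left; apply/eqP.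
by move: (expR _) (expR _) (n%:R ^+ n) => x y z; ring.
Unshelve. all: by end_near.
Qed.

Lemma increasing_trees_half (n k : nat) : (1 < n)%N -> (39 * n < 100 * k)%N -> (k.*2 <= n)%N ->
  #|increasing_trees n k|%:R <= n%:R * n%:R ^+ n * expR (- (1 / 100 * n%:R)) :> R.
Proof.
move=> n1 kn nk; have := card_increasing_half n1 nk.
have k0 : (0 < k)%N by lia.
have nk0 : (0 < n - k)%N by lia.
have n0R : 0 < n%:R :> R by rewrite ltr0n ltnW.
have k0R : 0 < k%:R :> R by rewrite ltr0n.
have nk0R : 0 < (n - k)%:R :> R by rewrite ltr0n.
have K0 : 0 < k%:R ^+ k * (n - k)%:R ^+ (n - k.*2) :> R by rewrite mulr_gt0 ?exprn_gt0.
rewrite -(ler_nat R) !natrM !natrX -ler_pdivlMr // => /le_trans; apply.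
rewrite -[leLHS]mulrA; apply: ler_wpM2l.
  by rewrite mulr_ge0 ?exprn_ge0 // ltW.
rewrite invfM mulrACA -!expr_div_n.
have Em : (n - k)%:R = n%:R - k%:R :> R by rewrite natrB //; lia.
have Eq : (n - k.*2)%:R = n%:R - 2 * k%:R :> R.
  by rewrite natrB -?mul2n ?natrM //; lia.
have B1 : (n - k.*2)%:R / k%:R <= expR ((n - k.*2)%:R / k%:R - 1) :> R.
  by apply: le_trans (expR_ge1Dx _); lra.
have B2 : n%:R / (n - k)%:R <= expR (k%:R / (n - k)%:R) :> R.
  apply: le_trans (expR_ge1Dx _); rewrite le_eqVlt; apply/orP; left; apply/eqP.
  by rewrite Em; field; rewrite -Em gt_eqF.
apply: (@le_trans _ _ (expR ((n - k.*2)%:R / k%:R - 1) ^+ k * expR (k%:R / (n - k)%:R) ^+ (n - k.*2))).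
  by apply: ler_pM; rewrite ?exprn_ge0 ?divr_ge0 ?ler0n // lerXn2r ?nnegrE ?divr_ge0 ?ler0n ?expR_ge0.
rewrite -!expRM_natl -expRD ler_expR.
have kN : 39 / 100 * n%:R <= k%:R :> R.
  move/ltnW: kn; rewrite -(ler_nat R) !natrM => H.
  by rewrite mulrAC ler_pdivrMr // [k%:R * _]mulrC.
have kN2 : 2 * k%:R <= n%:R :> R by rewrite -natrM ler_nat mul2n.
rewrite Em Eq; rewrite Em in nk0R.
move: (n%:R : R) (k%:R : R) n0R k0R nk0R kN kN2 => N K N0 K0' M0 KN KN2.
(* The numerator is negative once K / N exceeds (3 - sqrt 5) / 2 = 0.3819..., which is why u = k
   suffices from 0.39 on. *)
rewrite (_ : K * _ + _ = (N ^+ 2 - 3 * N * K + K ^+ 2) / (N - K)); last first.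
  by field; rewrite !gt_eqF.
rewrite ler_pdivrMr //; nra.
Qed.

Lemma increasing_trees_tail : exists2 d : R, 0 < d &
  \forall n \near \oo, forall k, (n * 130 %/ 375 <= k)%N ->
    #|increasing_trees n k|%:R <= expR 3 * n%:R ^+ 4 * n%:R ^+ n * expR (- (d * n%:R)) :> R.
Proof.
have [d d0 near_d] := increasing_trees_near.
exists (Num.min d (1 / 100)); first by rewrite lt_min d0 divr_gt0.
near=> n => k k0k.
have n1 : (1 < n)%N by near: n; exact: nbhs_infty_ge.
have n1R : 1 <= n%:R :> R by rewrite ler1n ltnW.
have n0R : 0 <= n%:R :> R by [].
have P0 : 0 <= expR 3 * n%:R ^+ 4 * n%:R ^+ n :> R.
  by rewrite !mulr_ge0 ?expR_ge0 ?exprn_ge0.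
have [nk|kn] := ltnP n k.*2.
  by rewrite increasing_trees_eq0 // mulr_ge0 ?expR_ge0.
have [k39|k39] := leqP (100 * k) (39 * n).
  have Hn : forall k, (n * 130 %/ 375 <= k)%N -> (100 * k <= 39 * n)%N ->
    #|increasing_trees n k|%:R <= expR 3 * n%:R ^+ 4 * n%:R ^+ n * expR (- (d * n%:R)) :> R.
    by near: n.
  apply: le_trans (Hn k k0k k39) _; apply: ler_wpM2l => //.
  by rewrite ler_expR lerN2 ler_wpM2r // ge_min lexx.
apply: le_trans (increasing_trees_half n1 k39 kn) _.
apply: ler_pM; rewrite ?expR_ge0 ?mulr_ge0 ?exprn_ge0 //; last first.
  by rewrite ler_expR lerN2 ler_wpM2r // ge_min lexx orbT.
rewrite ler_wpM2r ?exprn_ge0 //.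
apply: (@le_trans _ _ (n%:R ^+ 4)); first by rewrite -[leLHS]expr1 ler_weXn2l.
by rewrite ler_peMl ?exprn_ge0 // ltW // expR_gt1 ltr0n.
Unshelve. all: by end_near.
Qed.

End Tail.

(* 34 / 10 ^+ 2 + 668 / 10 ^+ 5 is 0.34668; ring_scope numerals are unary, and
   a numerator as large as 34668 overflows the stack. *)
Theorem theorem1p4 (R : realType) :
  (fun n : nat =>
     prob_random_tree R (fun T : {set {set 'I_n}} =>
       [forall k : 'I_n,
          ((34 / 10 ^+ 2 + 668 / 10 ^+ 5) * n%:R <= k%:R :> R) ==>
          (num_independent T k.+1 <= num_independent T k)%N]))
  @ \oo --> (1 : R).
Proof.
have [d d0 tail] := increasing_trees_tail R.
(* The exponent 7 is 4 from the tail bound, 1 from the union over k, and 2 from Cayley's bound. *)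
apply: (@squeeze_cvgr _ _ _ _ (fun n => 1 - expR 3 * n%:R ^+ 7 * expR (- (d * n%:R))) (fun=> 1)); last 2 first.
- by rewrite -[X in _ --> X]subr0; apply: cvgB; [exact: cvg_cst|exact: cvg_expn_expR].
- exact: cvg_cst.
near=> n.
have n1 : (1 < n)%N by near: n; exact: nbhs_infty_ge.
have tail_n : forall k, (n * 130 %/ 375 <= k)%N ->
    #|increasing_trees n k|%:R <= expR 3 * n%:R ^+ 4 * n%:R ^+ n * expR (- (d * n%:R)) :> R.
  by near: n.
have n0R : 0 < n%:R :> R by rewrite ltr0n ltnW.
have cay : n%:R ^+ n <= n%:R ^+ 2 * #|trees 'I_n|%:R :> R.
  have := card_trees_ge (Ordinal n1); rewrite card_ord => H.
  by rewrite -!natrX -natrM ler_nat.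
have t0 : 0 < #|trees 'I_n|%:R :> R.
  rewrite -(pmulr_rgt0 _ (exprn_gt0 2 n0R)); apply: lt_le_trans cay.
  exact: exprn_gt0.
set c : R := 34 / 10 ^+ 2 + 668 / 10 ^+ 5.
pose good := [set T in trees 'I_n | [forall k : 'I_n,
  (c * n%:R <= k%:R :> R) ==> (num_independent T k.+1 <= num_independent T k)%N]].
rewrite -[prob_random_tree _ _]/(#|good|%:R / #|trees 'I_n|%:R).
apply/andP; split; last first.
  rewrite ler_pdivrMr // mul1r ler_nat; apply: subset_leq_card.
  by apply/fintype.subsetP => T; rewrite !inE => /andP[].
pose bad := trees 'I_n :\: good.
have badE : bad \subset \bigcup_(k < n | (c * n%:R <= k%:R :> R)) increasing_trees n k.
  apply/fintype.subsetP => T; rewrite !inE => /andP[ng tT].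
  move: ng; rewrite tT /= => /forallPn[k]; rewrite negb_imply -ltnNge => /andP[ck lt].
  by apply/bigcupP; exists k => //; rewrite !inE tT.
have bad_le : #|bad|%:R <= n%:R * (expR 3 * n%:R ^+ 4 * n%:R ^+ n * expR (- (d * n%:R))) :> R.
  apply: (@le_trans _ _ (\sum_(k < n | (c * n%:R <= k%:R :> R)) #|increasing_trees n k|%:R)).
    rewrite -natr_sum ler_nat; apply: leq_trans (subset_leq_card badE) _.
    apply: (big_ind2 (fun (A : {set {set {set 'I_n}}}) m => #|A| <= m)%N) => [|A a B b Aa Bb|//].
      by rewrite cards0.
    by apply: leq_trans (leq_card_setU A B) _; apply: leq_add.
  apply: (@le_trans _ _ (\sum_(k < n | (c * n%:R <= k%:R :> R))
      (expR 3 * n%:R ^+ 4 * n%:R ^+ n * expR (- (d * n%:R))))).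
    apply: ler_sum => k ck; apply: tail_n.
    (* This holds because 130 / 375 = 0.34666... is below 0.34668. *)
    suff : (n * 130 <= k * 375)%N by move=> H; rewrite -ltnS ltn_divLR //; lia.
    rewrite -(ler_nat R) !natrM.
    by move: ck; rewrite /c; move: (n%:R : R) (k%:R : R) n0R => x y x0; lra.
  rewrite sumr_const -[leLHS]mulr_natl ler_wpM2r //.
  by rewrite ler_nat -[leqRHS]card_ord max_card.
have good_bad : #|good|%:R = #|trees 'I_n|%:R - #|bad|%:R :> R.
  have gT : good \subset trees 'I_n by apply/fintype.subsetP => T; rewrite inE => /andP[].
  rewrite /bad cardsDS // natrB ?subset_leq_card //.
  by rewrite opprB addrCA subrr addr0.
rewrite good_bad mulrBl divff ?gt_eqF // lerD2l lerN2 ler_pdivrMr //.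
apply: le_trans bad_le _.
set e := expR (- _); set e3 := expR 3.
have e0 : 0 <= e by apply: expR_ge0.
have e30 : 0 <= e3 by apply: expR_ge0.
have W0 : 0 <= e3 * n%:R ^+ 5 * e by rewrite !mulr_ge0 ?exprn_ge0 // ltW.
have := ler_wpM2l W0 cay.
move: (n%:R ^+ n) (#|trees 'I_n|%:R) => X Y H.
rewrite (_ : _ * (_ * X * _) = e3 * n%:R ^+ 5 * e * X); last by ring.
rewrite (_ : _ * Y = e3 * n%:R ^+ 5 * e * (n%:R ^+ 2 * Y)) //; ring.
Unshelve. all: by end_near.
Qed.
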